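(* Let $G$ be a finite simple graph of order $n\ge 5$. Then the equality $$\mathcal E(G)=r(G)+\bar d(G)-1$$ holds if and only if $G\cong K_n$, or $n$ is even and $G\cong \frac n2K_2$.
   Context: For a finite simple graph $G$ with $n$ vertices and $m$ edges, let $A(G)$ be its adjacency matrix with eigenvalues $\lambda_1\ge\cdots\ge\lambda_n$ (counted with multiplicity). The energy is $\mathcal E(G)=\sum_{i=1}^n|\lambda_i|$, $r(G)=\operatorname{rank}A(G)$ (rank over $\mathbb R$), and $\bar d(G)=2m/n$ is the average degree. $K_n$ is the complete graph on $n$ vertices, and $\frac n2K_2$ is the disjoint union of $n/2$ copies of $K_2$ (a perfect matching on $n$ vertices). *)

(* Defs.v *)
From mathcomp Require Import all_boot all_order all_algebra.
From mathcomp Require Import complex polyrcf.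
From mathcomp Require Import reals.

Set Implicit Arguments.
Unset Strict Implicit.
Unset Printing Implicit Defensive.

Import Order.TTheory GRing.Theory Num.Theory.
Local Open Scope ring_scope.

Record sgraph := SGraph {
  vertex :> finType;
  adj : rel vertex;
  adj_sym : symmetric adj;
  adj_irrefl : irreflexive adj
}.

Definition graph_iso (G H : sgraph) : Prop :=
  exists2 f : G -> H, bijective f & forall x y, adj (f x) (f y) = adj x y.

Definition edges (G : sgraph) : {set {set G}} :=
  [set E : {set G} | [exists x, exists y, adj x y && (E == [set x; y])]].

Section Complete.
Variable n : nat.
Definition complete_adj : rel 'I_n := fun i j => i != j.
Lemma complete_sym : symmetric complete_adj.
Proof. by move=> i j; rewrite /complete_adj eq_sym. Qed.
Lemma complete_irrefl : irreflexive complete_adj.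
Proof. by move=> i; rewrite /complete_adj eqxx. Qed.
Definition complete : sgraph := SGraph complete_sym complete_irrefl.
End Complete.

Section Copies.
Variables (k : nat) (G : sgraph).
Definition copies_adj : rel ('I_k * G)%type :=
  fun u v => (u.1 == v.1) && adj u.2 v.2.
Lemma copies_sym : symmetric copies_adj.
Proof. by move=> u v; rewrite /copies_adj eq_sym adj_sym. Qed.
Lemma copies_irrefl : irreflexive copies_adj.
Proof. by move=> u; rewrite /copies_adj adj_irrefl andbF. Qed.
Definition copies : sgraph := SGraph copies_sym copies_irrefl.
End Copies.

Section Spectrum.
Variable R : realType.

(* The real eigenvalues in decreasing order, each repeated according to its
   multiplicity as a root of the characteristic polynomial.  For a symmetric
   matrix these are all n eigenvalues: see char_poly_eigenvalues. *)
Definition eigenvalues n (A : 'M[R]_n) : seq R :=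
  let p := char_poly A in
  sort (fun x y => y <= x) (flatten [seq nseq (mup x p) x | x <- rootsR p]).

Lemma sym_char_poly_split n (A : 'M[R]_n) : A^T = A ->
  exists s : seq R, char_poly A = \prod_(x <- s) ('X - x%:P).
Proof.
move=> symA; pose f := real_complex R; pose B := map_mx f A.
have hB : B \is hermsymmx.
  apply: realsym_hermsym.
    apply/is_hermitianmxP.
    rewrite expr0 scale1r map_mx_id //.
    by rewrite /B map_trmx symA.
  by apply/mxOverP => i j; rewrite mxE; apply/complex_realP; exists (A i j).
have /mxOverP dreal := hermitian_spectral_diag_real hB.
have /hermitian_normalmx/orthomx_spectralP eB := hB.
pose d i := complex.Re (spectral_diag B 0 i).
exists [seq d i | i <- enum 'I_n]; apply: (map_poly_inj f).
rewrite map_char_poly -/B.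
have -> : char_poly B = char_poly (diag_mx (spectral_diag B)).
  have Pu := spectral_unit B.
  rewrite {1}eB /char_poly /char_poly_mx.
  set P := spectralmx B; set D := diag_mx _.
  have PV : map_mx polyC (invmx P) *m map_mx polyC P = 1%:M.
    by rewrite -map_mxM mulVmx // map_mx1.
  have -> : 'X%:M - map_mx polyC (invmx P *m D *m P) =
      map_mx polyC (invmx P) *m ('X%:M - map_mx polyC D) *m map_mx polyC P.
    rewrite mulmxBr mulmxBl !map_mxM; congr (_ - _).
    by rewrite scalar_mxC -mulmxA PV mulmx1.
  rewrite !det_mulmx mulrAC -det_mulmx PV det1 mul1r //.
rewrite char_poly_trig; last exact/diag_mx_is_trig.
rewrite big_map rmorph_prod big_enum /=; apply: eq_bigr => i _.
rewrite mxE eqxx mulr1n rmorphB /= map_polyX map_polyC /=.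
by have /complex_realP[k ek] := dreal 0 i; rewrite /d ek.
Qed.

Lemma char_poly_eigenvalues n (A : 'M[R]_n) : A^T = A ->
  char_poly A = \prod_(x <- eigenvalues A) ('X - x%:P).
Proof.
move=> /sym_char_poly_split [s es].
have p0 : char_poly A != 0 by rewrite monic_neq0 ?char_poly_monic.
rewrite {1}es; apply: perm_big; rewrite perm_sym /eigenvalues perm_sort.
apply/allP => x _; apply/eqP => /=; rewrite -(mu_prod_XsubC x s) -es.
rewrite count_flatten -map_comp sumnE big_map.
under eq_bigr => y _ do rewrite /= count_nseq /=.
have [xr | xr] := boolP (x \in rootsR (char_poly A)).
  rewrite (bigD1_seq x) ?uniq_roots //= eqxx mul1n big1 ?addn0 // => y yx.
  by rewrite (negbTE yx).
rewrite big_seq big1 => [|y yr]; last first.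
  by case: eqP => // exy; rewrite -exy yr in xr.
rewrite mupNroot //; apply: contra xr => xr.
by rewrite -(roots_on_rootsR p0) xr andbT in_itv.
Qed.

Lemma size_eigenvalues n (A : 'M[R]_n) : A^T = A -> size (eigenvalues A) = n.
Proof.
move=> /char_poly_eigenvalues/(congr1 (fun p : {poly R} => size p)).
by rewrite size_char_poly size_prod_XsubC => -[].
Qed.

End Spectrum.

Section Invariants.
Variables (R : realType) (G : sgraph).

Definition adjmx : 'M[R]_#|G| :=
  \matrix_(i, j) (adj (enum_val i) (enum_val j))%:R.

Lemma adjmx_sym : adjmx^T = adjmx.
Proof. by apply/matrixP => i j; rewrite !mxE adj_sym. Qed.

Definition energy : R := \sum_(x <- eigenvalues adjmx) `|x|.

Definition graph_rank : nat := \rank adjmx.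

Definition avg_degree : R := 2 * #|edges G|%:R / #|G|%:R.

End Invariants.

(* Main.v *)
(** Equality makes the energy rational.  It is twice the sum T of the positive
    eigenvalues, and if k of them are positive, then T is the largest sum of k
    eigenvalues and is attained only once.  Symmetric integer polynomials in the
    eigenvalues take integer values, so Lagrange interpolation at the k-term
    sums shows that T is an integer and that the positive, and likewise the
    negative, eigenvalues have a product of absolute value at least 1.

    Let λ be an eigenvalue that is at least the average degree d (Rayleigh), a
    the other positive eigenvalues, b the absolute values of the negative ones.
    Equality gives Σ(b - 1) = w and Σ(a - 1) = -(w + λ - d) for a natural number
    w, and tr A² = nd then determines Σ(a - 1)² + Σ(b - 1)².  If w > 0, this is
    too large, because (x - 1)² <= 2y² + 3y for y = x - 1 - ln x, and the sum of
    all y is at most ln λ - (λ - d).  Hence w = 0, every b is 1 and A + I is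
    positive semidefinite.  So G has no induced path on three vertices, it is a
    disjoint union of cliques, its eigenvalues are integers, and Σ(a - 1) <= 0
    forces every a to be 1.  Now tr A² leaves only K_n and the perfect
    matchings. *)
Require Import Defs.
From mathcomp Require Import all_boot all_order all_algebra.
From mathcomp Require Import reals.
From mathcomp Require Import perm mpoly complex.
From mathcomp Require Import classical_sets topology normedtype derive realfun.
From mathcomp Require Import sequences exp finset.
From mathcomp Require Import ring lra zify.

Set Implicit Arguments.
Unset Strict Implicit.
Unset Printing Implicit Defensive.

Import Order.TTheory GRing.Theory Num.Theory numFieldNormedType.Exports.
Local Open Scope ring_scope.

(** * Symmetric functions of the eigenvalues *)

Section SymmetricValues.
Variables (R : archiRealFieldType) (n : nat) (l : 'I_n -> R).

Definition evalz (f : {mpoly int[n]}) : R := mmap intr l f.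

Lemma evalz_comp (t : {mpoly int[n]}) (s : n.-tuple {mpoly int[n]}) :
  evalz (t \mPo s) = mmap intr (fun i => evalz (tnth s i)) t.
Proof.
rewrite /evalz comp_mpolyE raddf_sum /=; apply: eq_bigr => m _.
rewrite mmapZ rmorph_prod /=; congr (_ * _); apply: eq_bigr => i _.
by rewrite rmorphXn.
Qed.

Lemma evalz_mesym k : evalz (mesym n int k) = (mesym n R k).@[l].
Proof.
rewrite /evalz !mesymE !raddf_sum; apply: eq_bigr => h _.
by rewrite /= mmapX mevalX.
Qed.

(** By the fundamental theorem [f] is an integer polynomial in the elementary symmetric polynomials,
    whose values at [l] are, up to sign, coefficients of [p]. *)
Lemma evalz_sym_int (p : {poly int}) (f : {mpoly int[n]}) :
  \prod_i ('X - (l i)%:P) = map_poly intr p -> f \is symmetric ->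
  evalz f \is a Num.int.
Proof.
move=> ep /sym_fundamental[t [<- _]]; rewrite evalz_comp.
rewrite rpred_sum // => m _; rewrite rpredM ?rpred_int //.
rewrite rpred_prod // => i _.
rewrite rpredX // tnth_mktuple evalz_mesym.
have hk : (i.+1 < n.+1)%N by rewrite ltnS.
have := mroots_coeff [tuple l i | i < n] (Ordinal hk).
rewrite big_tuple; under eq_bigr do rewrite tnth_mktuple.
rewrite ep coef_map /= => e; rewrite -(rpredMsign _ i.+1).
rewrite (_ : meval _ _ = meval (tnth [tuple l i | i < n]) (mesym n R i.+1)).
  by rewrite -e rpred_int.
by apply: meval_eq => j; rewrite tnth_mktuple.
Qed.

(* The factors S' make this vanish, at a point where a / b is one of the k-term
   sums, except for the term of the subset S attaining that sum. *)
Definition subset_poly k (a b : int) (h : {set 'I_n} -> {mpoly int[n]}) :=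
  \sum_(S : {set 'I_n} | #|S| == k) h S *
     \prod_(S' : {set 'I_n} | (#|S'| == k) && (S' != S))
        (a%:MP - b *: \sum_(i in S') 'X_i).

(** A permutation of the variables permutes the subsets of size [k], and hence the summands once [h]
    is equivariant. *)
Lemma subset_poly_sym k a b h :
  (forall (s : 'S_n) S, msym s (h S) = h [set s i | i in S]) ->
  subset_poly k a b h \is symmetric.
Proof.
move=> hs; apply/issymP => s; rewrite /subset_poly.
have bij := injF_bij (imset_inj (@perm_inj _ s)).
rewrite [RHS](reindex _ (onW_bij _ bij)) raddf_sum /=.
have card (S : {set 'I_n}) : #|[set s i | i in S]| = #|S|.
  by rewrite card_imset //; apply: perm_inj.
apply: eq_big => [S|S _]; first by rewrite card.
rewrite rmorphM rmorph_prod /= hs; congr (_ * _).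
rewrite [RHS](reindex _ (onW_bij _ bij)) /=.
apply: eq_big => [S'|S' _].
  by rewrite card (inj_eq (bij_inj bij)).
rewrite rmorphB /= msymZ (raddf_sum (msym s)) /=; congr (_ - _).
  by rewrite /msym mmapC.
congr (_ *: _).
rewrite big_imset /=; last by move=> x y _ _; apply: perm_inj.
by apply: eq_bigr => i _; rewrite /msym mmapX mmap1U.
Qed.

Lemma subset_poly_eval k (a b : int) (h : {set 'I_n} -> {mpoly int[n]})
    (P : {set 'I_n}) :
  #|P| = k -> a%:~R = b%:~R * \sum_(i in P) l i ->
  evalz (subset_poly k a b h) = evalz (h P) *
     \prod_(S : {set 'I_n} | (#|S| == k) && (S != P))
        (a%:~R - b%:~R * \sum_(i in S) l i).
Proof.
move=> cP eP; have ev (S : {set 'I_n}) : evalz (a%:MP - b *: \sum_(i in S) 'X_i) =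
    a%:~R - b%:~R * \sum_(i in S) l i.
  rewrite /evalz rmorphB /= mmapC mmapZ (raddf_sum (mmap _ _)) /=.
  by congr (_ - _ * _); apply: eq_bigr => i _; rewrite mmapX mmap1U.
rewrite /subset_poly {1}/evalz (raddf_sum (mmap _ _)) /=.
rewrite (bigD1 P) /=; last by rewrite cP.
rewrite [X in _ + X]big1 => [|S /andP[cS SP]].
  rewrite addr0 rmorphM rmorph_prod /=; congr (_ * _).
  by apply: eq_bigr => S _; apply: ev.
(* For [S != P] the product contains the factor with [S' = P], which is zero by [eP]. *)
rewrite rmorphM rmorph_prod /= [X in _ * X](bigD1 P) /=; last first.
  by rewrite cP eqxx eq_sym.
have := ev P; rewrite /evalz => ->; by rewrite eP subrr mul0r mulr0.
Qed.
End SymmetricValues.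

(** * Sum and product of the positive values *)

Section PositivePart.
Variables (R : archiRealFieldType) (n : nat) (l : 'I_n -> R).

(** Outside the common part [S] contributes nothing positive, while [P :\: S] is nonempty because
    the cardinalities agree. *)
Lemma sum_pos_part_gt (S : {set 'I_n}) (P := [set i | 0 < l i]) :
  #|S| = #|P| -> S != P -> \sum_(i in S) l i < \sum_(i in P) l i.
Proof.
move=> cSP nSP; rewrite (big_setID P) [X in _ < X](big_setID S) /= setIC ltrD2l.
apply: (@le_lt_trans _ _ 0).
  by apply: sumr_le0 => i; rewrite !inE -leNgt => /andP[].
have pos i : i \in P :\: S -> 0 < l i by rewrite !inE => /andP[].
have /set0Pn[i iPS] : P :\: S != set0.
  apply: contra nSP; rewrite setD_eq0 => sPS.
  by rewrite eq_sym eqEcard sPS cSP /=.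
by rewrite (bigD1 i) //= ltr_pwDl ?pos // sumr_ge0 // => k /andP[/pos/ltW].
Qed.

(** [D] is the product of [b] times the gaps between the maximal subset sum and the others. It is
    the same for all [j]: only the [h] of [subset_poly] varies, as a power of the subset sum or
    product. *)
Lemma pos_part_int_mul (p : {poly int}) (a b : int) (P := [set i | 0 < l i]) :
    \prod_i ('X - (l i)%:P) = map_poly intr p -> (0 < b) ->
    a%:~R = b%:~R * \sum_(i in P) l i ->
  exists2 D : R, 0 < D & forall j,
    ((\sum_(i in P) l i) ^+ j * D \is a Num.int) /\
    ((\prod_(i in P) l i) ^+ j * D \is a Num.int).
Proof.
move=> ep b0 eP.
exists (\prod_(S : {set 'I_n} | (#|S| == #|P|) && (S != P))
        (a%:~R - b%:~R * \sum_(i in S) l i)).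
  apply: prodr_gt0 => S /andP[/eqP cS SP].
  by rewrite eP -mulrBr mulr_gt0 ?ltr0z // subr_gt0 sum_pos_part_gt.
move=> j; split.
  have := evalz_sym_int ep (@subset_poly_sym _ #|P| a b
    (fun S => (\sum_(i in S) 'X_i) ^+ j) _).
  rewrite (subset_poly_eval _ erefl eP) /evalz rmorphXn (raddf_sum (mmap _ _)) /=.
  under eq_bigr do rewrite mmapX mmap1U.
  apply=> s S; rewrite rmorphXn (raddf_sum (msym s)) /=; congr (_ ^+ _).
  rewrite [RHS]big_imset /=; last by move=> x y _ _; apply: perm_inj.
  by apply: eq_bigr => i _; rewrite /msym mmapX mmap1U.
have := evalz_sym_int ep (@subset_poly_sym _ #|P| a b
  (fun S => (\prod_(i in S) 'X_i) ^+ j) _).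
rewrite (subset_poly_eval _ erefl eP) /evalz rmorphXn rmorph_prod /=.
under eq_bigr do rewrite mmapX mmap1U.
apply=> s S; rewrite rmorphXn rmorph_prod /=; congr (_ ^+ _).
rewrite [RHS]big_imset /=; last by move=> x y _ _; apply: perm_inj.
by apply: eq_bigr => i _; rewrite /msym mmapX mmap1U.
Qed.

(** If [x < 1], the numbers [x ^+ j * D] would be a strictly decreasing sequence of positive
    integers. The induction is on a bound [m] for [D] and passes from [D] to [x * D]. *)
Lemma ge1_of_powers_int (x D : R) : 0 < x -> 0 < D ->
  (forall j, x ^+ j * D \is a Num.int) -> 1 <= x.
Proof.
move=> x0 D0 xD; rewrite leNgt; apply/negP => x1.
have [m] : exists m : nat, D < m%:R by exists (Num.truncn D).+1; apply: truncnS_gt.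
elim: m D D0 xD => [|m IHm] D D0 xD Dm; first by rewrite ltNge ltW in Dm.
apply: (IHm (x * D)); first by rewrite mulr_gt0.
  by move=> j; rewrite mulrA -exprSr.
have /intrP[d ed] := xD 0; have /intrP[e ee] := xD 1.
rewrite expr0 mul1r in ed; rewrite expr1 in ee.
have : x * D < D by rewrite gtr_pMl.
move: Dm; rewrite ee ed !pmulrn !ltr_int.
lia.
Qed.

(** The fractional part [y] inherits the hypothesis through the binomial formula, and [y < 1] then
    leaves only [y = 0]. *)
Lemma int_of_powers_int (x D : R) : 0 < D ->
  (forall j, x ^+ j * D \is a Num.int) -> x \is a Num.int.
Proof.
move=> D0 xD; pose y := x - (Num.floor x)%:~R.
have y0 : 0 <= y by rewrite subr_ge0 floor_le.
have [|y0' |/eqP] := ltgtP y 0; first by rewrite ltNge y0.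
  have := @ge1_of_powers_int y D y0' D0.
  have y1 : y < 1 by rewrite ltrBlDl -[1]/(1%:~R) -intrD floorD1_gt.
  rewrite leNgt y1 /= => h; suff : false by []. apply: h => j.
  rewrite exprDn mulr_suml rpred_sum // => i _.
  rewrite mulrnAl rpredMn // mulrAC rpredM // rpredX // rpredN rpred_int //.
by rewrite subr_eq0 => /eqP->; rewrite rpred_int.
Qed.

Lemma pos_part_int (p : {poly int}) (a b : int) (P := [set i | 0 < l i]) :
    \prod_i ('X - (l i)%:P) = map_poly intr p -> 0 < b ->
    a%:~R = b%:~R * \sum_(i in P) l i ->
  \sum_(i in P) l i \is a Num.int /\ 1 <= \prod_(i in P) l i.
Proof.
move=> ep b0 eP; have [D D0 hD] := pos_part_int_mul ep b0 eP.
split; first by apply: int_of_powers_int D0 _ => j; case: (hD j).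
apply: ge1_of_powers_int D0 _ => [|j]; last by case: (hD j).
by apply: prodr_gt0 => i; rewrite inE.
Qed.
End PositivePart.

(** * Logarithmic inequalities *)

Section LogInequalities.
Variable R : realType.

(** Meant for [y = x - 1 - ln x], where the hypothesis is [ln_le_pade] with denominators cleared. *)
Lemma sqr_subr1_le (x y : R) : 0 < x -> 3 * (x - 1) ^+ 2 <= (4 * x + 2) * y ->
  (x - 1) ^+ 2 <= 2 * y ^+ 2 + 3 * y.
Proof.
move=> x0 h; have d : 0 < 4 * x + 2 by lra.
have y0 : 0 <= y.
  by rewrite -(pmulr_rge0 _ d); apply: le_trans h; rewrite mulr_ge0 ?sqr_ge0.
(* Up to this threshold [4 * x + 2 <= 6 * y + 9], which gives the claim. Above it [h] fails: with
   [t = x - 1], the expression [3 * t ^+ 2 - (4 * t + 6) * y] is [3 / 4 * (y - 3 / 2) ^+ 2] at the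
   threshold and increases from there. *)
have [c|c] := lerP (x - 1) (3 / 2 * y + 3 / 4).
  have : 0 <= y * (3 / 2 * y + 3 / 4 - (x - 1)) by rewrite mulr_ge0 // subr_ge0.
  nra.
have s := sqr_ge0 (y - 3 / 2).
have : 0 <= (x - 1 - (3 / 2 * y + 3 / 4)) * y by apply: mulr_ge0 => //; lra.
have : 0 < (x - 1 - (3 / 2 * y + 3 / 4)) by lra.
nra.
Qed.

(** With [u] the cube root of [lam], [g] is an upper bound for [ln lam]; this inequality closes
    [clash_ge3]. *)
Lemma pade_cubic_bound (u : R) : 1 <= u ->
  let g := 3 * (u - 1) * (u + 5) / (4 * u + 2) in
  u * (2 * g ^+ 2 + 3 * g) < 6 * (u ^+ 3 - g).
Proof.
move=> u1 /=; set g := _ / _.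
have d : 0 < 4 * u + 2 by lra.
have eg : g * (4 * u + 2) = 3 * (u - 1) * (u + 5) by rewrite /g divfK // gt_eqF.
rewrite -subr_gt0 -(pmulr_lgt0 _ (exprn_gt0 2 d)).
set e := (X in 0 < X).
have -> : e = 6 * u ^+ 3 * (4 * u + 2) ^+ 2 - 6 * (g * (4 * u + 2)) * (4 * u + 2)
   - u * (2 * (g * (4 * u + 2)) ^+ 2 + 3 * (g * (4 * u + 2)) * (4 * u + 2)).
  by rewrite /e; ring.
rewrite eg.
have -> : u = 1 + (u - 1) by ring.
set v := u - 1; have v0 : 0 <= v by rewrite /v; lra.
clearbody v; clear -v0.
have h1 := sqr_ge0 (v ^+ 2 - 1 / 2).
have h2 : 0 <= (v + 6 / 5) * (v - 3 / 5) ^+ 2 by rewrite mulr_ge0 ?sqr_ge0 //; lra.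
have h3 : 0 <= v ^+ 5 by rewrite exprn_ge0.
have h4 := sqr_ge0 (v - 3 / 5).
nra.
Qed.

(** The right side is the [2/1] Padé approximant of [ln] at 1. The difference [h] vanishes at 1 and
    its derivative has the sign of [y - 1]. *)
Lemma ln_le_pade (x : R) : 0 < x -> ln x <= (x - 1) * (x + 5) / (4 * x + 2).
Proof.
move=> x0; pose h (y : R) := (y - 1) * (y + 5) / (4 * y + 2) - ln y.
pose dh (y : R) := 4 * (y - 1) ^+ 3 / (y * (4 * y + 2) ^+ 2).
have der (y : R) : 0 < y -> is_derive y 1 h (dh y).
  move=> y0; rewrite /h /dh.
  have d : 4 * y + 2 != 0 by rewrite gt_eqF //; lra.
  have := is_derive1_ln y0 => dl.
  apply: is_derive_eq.
  rewrite /GRing.scale /=.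
  by field; rewrite d gt_eqF.
have h1 : h 1 = 0 by rewrite /h ln1 subrr !mul0r subr0.
suff : 0 <= h x by rewrite /h subr_ge0.
have dh_sg (c : R) : 0 < c -> 0 <= dh c * (c - 1).
  move=> c0; rewrite /dh mulrAC -(mulrA 4) -exprSr.
  rewrite divr_ge0 //; first by rewrite mulr_ge0 // exprn_even_ge0.
  by rewrite mulr_ge0 ?sqr_ge0 // ltW.
have cont (a b : R) : 0 < a -> {within `[a, b], continuous h}%classic.
  move=> a0; apply: derivable_within_continuous => y.
  rewrite in_itv /= => /andP[ay _].
  by have := der y (lt_le_trans a0 ay) => /@ex_derive.
have dr (a b : R) : 0 < a -> forall y : R, y \in `]a, b[ -> is_derive y 1 h (dh y).
  move=> a0 y; rewrite in_itv /= => /andP[ay _]; exact: der (lt_trans a0 ay).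
have [x1|x1|->] := ltgtP x 1; last by rewrite h1.
- have [c + e] := MVT x1 (dr _ _ x0) (cont _ _ x0).
  rewrite in_itv /= => /andP[xc c1]; have := dh_sg c (lt_trans x0 xc).
  have : 0 < 1 - c by rewrite subr_gt0.
  move: e; rewrite h1; nra.
- have [c + e] := MVT x1 (dr _ _ ltr01) (cont _ _ ltr01).
  rewrite in_itv /= => /andP[xc c1]; have := dh_sg c (lt_trans ltr01 xc).
  have : 0 < c - 1 by rewrite subr_gt0.
  move: e; rewrite h1; nra.
Qed.

Lemma ln_le_subr1 (x : R) : 0 < x -> ln x <= x - 1.
Proof.
move=> x0; have -> : x = 1 + (x - 1) by ring.
by apply: le_trans (le_ln1Dx _) _; lra.
Qed.

Lemma ln_prod (I : finType) (P : {set I}) (x : I -> R) :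
  (forall i, i \in P -> 0 < x i) -> ln (\prod_(i in P) x i) = \sum_(i in P) ln (x i).
Proof.
move=> x0; suff [] : 0 < \prod_(i in P) x i /\
   ln (\prod_(i in P) x i) = \sum_(i in P) ln (x i) by [].
elim/big_rec2: _ => [|i y1 y2 /x0 xi [y0 ey]]; first by rewrite ln1.
by rewrite mulr_gt0 // lnM ?posrE // ey.
Qed.

(** For nonnegative [y] the expression [2 * y ^+ 2 + 3 * y] is superadditive, so the pointwise bound
    survives summation. *)
Lemma sum_sq_le_ln (I : finType) (P : {set I}) (x : I -> R)
    (Y := \sum_(i in P) (x i - 1 - ln (x i))) :
  (forall i, i \in P -> 0 < x i) ->
  0 <= Y /\ \sum_(i in P) (x i - 1) ^+ 2 <= 2 * Y ^+ 2 + 3 * Y.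
Proof.
move=> x0; rewrite /Y.
elim/big_rec2: _ => [|i q y /x0 xi [y0 hq]]; first by rewrite expr0n !mulr0 addr0.
have h := ln_le_subr1 xi; set t := x i - 1 - ln (x i).
have t0 : 0 <= t by rewrite /t; lra.
have ht : (x i - 1) ^+ 2 <= 2 * t ^+ 2 + 3 * t.
  apply: sqr_subr1_le => //.
  have d : 0 < 4 * x i + 2 by lra.
  have := ln_le_pade xi; rewrite ler_pdivlMr // => hp.
  by rewrite /t; nra.
have := mulr_ge0 t0 y0; split; first exact: addr_ge0.
nra.
Qed.

(* The x i are absolute values of eigenvalues: P indexes the positive ones other
   than lam, N the negative ones; lam - eps is the average degree and z the
   number of zero eigenvalues. *)
Section Clash.
Variables (I : finType) (P N : {set I}) (x : I -> R) (lam eps z : R) (w : nat).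
Let s := \sum_(i in P) x i.
Hypotheses (Px : forall i, i \in P -> 0 < x i) (Nx : forall i, i \in N -> 0 < x i).
Hypotheses (lam0 : 0 < lam) (prodP : 1 <= lam * \prod_(i in P) x i).
Hypotheses (prodN : 1 <= \prod_(i in N) x i) (w0 : (0 < w)%N) (eps0 : 0 <= eps).
Hypotheses (dge0 : 0 <= lam - eps) (z0 : 0 <= z).
Hypotheses (sumN : \sum_(i in N) (x i - 1) = w%:R).
Hypotheses (sumP : \sum_(i in P) (x i - 1) = - (w%:R + eps)).
Hypothesis sq : \sum_(i in P) (x i - 1) ^+ 2 + \sum_(i in N) (x i - 1) ^+ 2
  + eps ^+ 2 = 2 * (lam - eps - 1) * s + (lam - eps) * z.

Let L := ln lam.
Let lnP : - L <= \sum_(i in P) ln (x i).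
Proof.
have pP : 0 < \prod_(i in P) x i by apply: prodr_gt0.
have := prodP; rewrite -ler_ln ?posrE ?mulr_gt0 // ln1 lnM ?posrE //.
by rewrite ln_prod // /L; lra.
Qed.
Let lnN : 0 <= \sum_(i in N) ln (x i).
Proof.
have pN : 0 < \prod_(i in N) x i by apply: prodr_gt0.
have := prodN; by rewrite -ler_ln ?posrE // ln1 ln_prod.
Qed.
Let sE : s = #|P|%:R - w%:R - eps.
Proof.
have := sumP; rewrite sumrB -/s.
by rewrite sumr_const; lra.
Qed.
Let wL : w%:R + eps <= L.
Proof.
have : \sum_(i in P) ln (x i) <= \sum_(i in P) (x i - 1).
  by apply: ler_sum => i /Px; apply: ln_le_subr1.
by rewrite sumP; have := lnP; lra.
Qed.
Let w1 : 1 <= w%:R :> R. Proof. by rewrite ler1n. Qed.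
Let wltP : (w < #|P|)%N.
Proof.
have [i iP] : exists i, i \in P.
  apply/set0Pn/eqP => P0; move: sumP; rewrite P0 big_set0.
  by have := eps0; have := w1; lra.
rewrite -(ltr_nat R); suff : 0 < s by rewrite sE; have := eps0; lra.
by rewrite /s (bigD1 i) //= ltr_pwDl ?Px ?sumr_ge0 // => j /andP[/Px/ltW].
Qed.

(** By [sq], [2 * (lam - eps - 1) * s] is at most [2 * L ^+ 2 + 3 * L], which is only quadratic in
    [ln lam]. But [s] is at least [3 / u] with [u] the cube root of [lam], so by [pade_cubic_bound]
    the product is too large. *)
Let clash_ge3 : (2 < #|P|)%N -> False.
Proof.
move=> K3; pose u := expR (L / 3).
have u0 : 0 < u by apply: expR_gt0.
have L1 : 1 <= L by have := wL; have := eps0; have := w1; lra.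
have u1 : 1 <= u by rewrite -expR0 ler_expR; lra.
have lnu : ln u = L / 3 by rewrite expRK.
have lamE : lam = u ^+ 3.
  rewrite -expRM_natl (_ : 3%:R * (L / 3) = L); last by field.
  by rewrite lnK ?posrE.
pose g := 3 * (u - 1) * (u + 5) / (4 * u + 2).
have Lg : L <= g.
  have := ln_le_pade u0; rewrite lnu /g; rewrite -!mulrA; lra.
(* AM-GM: s >= K lam^(-1/K) for K = #|P|, and the bound is weakest at K = 3. *)
have su : 3 <= s * u.
  have : \sum_(i in P) (1 + ln (x i) + L / 3) <= s * u.
    rewrite mulr_suml; apply: ler_sum => i /Px xi.
    have := ln_le_subr1 (mulr_gt0 xi u0); rewrite lnM ?posrE // lnu; lra.
  rewrite !big_split /= !sumr_const.
  have K3' : 3 <= #|P|%:R :> R by rewrite (ler_nat _ 3).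
  rewrite -[L / 3 *+ _]mulr_natr.
  have := lnP; nra.
have [YP0 hP] := sum_sq_le_ln Px; have [YN0 hN] := sum_sq_le_ln Nx.
rewrite [X in _ <= X]sumrB sumN in YN0.
rewrite [X in _ <= X]sumrB sumP in YP0.
rewrite [X in 2 * X ^+ 2 + 3 * X]sumrB sumN in hN.
rewrite [X in 2 * X ^+ 2 + 3 * X]sumrB sumP in hP.
move: sq (lnP) (lnN) (wL) (w1).
set QP := \sum_(i in P) (_ - _) ^+ 2 in hP *.
set QN := \sum_(i in N) (_ - _) ^+ 2 in hN *.
set SP := \sum_(i in P) ln _ in YP0 hP *.
set SN := \sum_(i in N) ln _ in YN0 hN *.
set yP := - (w%:R + eps) - SP in YP0 hP; set yN := w%:R - SN in YN0 hN.
move=> eQ hSP hSN hw hw1.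
(* In the sum [w] cancels, and all the logarithms together amount to at least [- L]. *)
have yL : yP + yN <= L - eps by rewrite /yP /yN; lra.
have Q1 : QP + QN <= 2 * (yP + yN) ^+ 2 + 3 * (yP + yN).
  by have := mulr_ge0 YP0 YN0; nra.
have Q2 : 2 * (yP + yN) ^+ 2 <= 2 * (L - eps) ^+ 2.
  have y0 := addr_ge0 YP0 YN0.
  by rewrite ler_pM2l // lerXn2r ?nnegrE // (le_trans y0 yL).
have Q3 : 2 * (L - eps) ^+ 2 + 3 * (L - eps) + eps ^+ 2 <= 2 * L ^+ 2 + 3 * L.
  have : 0 <= eps * (L - eps) by rewrite mulr_ge0 //; lra.
  by have := eps0; nra.
have D1 : 2 * (lam - eps - 1) * s <= 2 * L ^+ 2 + 3 * L.
  by have := mulr_ge0 dge0 z0; lra.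
have pb : u * (2 * g ^+ 2 + 3 * g) < 6 * (u ^+ 3 - g) := pade_cubic_bound u1.
have g0 : 0 <= g by lra.
have gb : 0 <= u * (2 * g ^+ 2 + 3 * g).
  apply: mulr_ge0; first exact: ltW.
  by have := sqr_ge0 g; lra.
(* Here [eps + 1 <= eps + w <= L <= g]. *)
have D2 : u ^+ 3 - g <= lam - eps - 1 by rewrite -lamE; lra.
have d1 : 0 <= lam - eps - 1 by lra.
have D3 : 6 * (u ^+ 3 - g) <= 2 * (lam - eps - 1) * (s * u).
  have : 0 <= (lam - eps - 1) * (s * u - 3) by rewrite mulr_ge0 // subr_ge0.
  by lra.
have D4 : 2 * (lam - eps - 1) * (s * u) <= u * (2 * g ^+ 2 + 3 * g).
  rewrite mulrA [_ * u]mulrC ler_pM2l //; apply: le_trans D1 _.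
  have : 0 <= (g - L) * (g + L) by apply: mulr_ge0; lra.
  by nra.
by lra.
Qed.

(** Now [w = 1] and [s = a + b = 1 - eps]. The estimates [QN <= 5] and [4 <= lam * (a + b)] turn
    [sq] into [0 <= - 2 * (a * b)]. *)
Let clash_2 : #|P| = 2%N -> False.
Proof.
move=> K2; have w_1 : w = 1%N by have := wltP; rewrite K2; case: (w) w0 => [|[]].
have [YN0 hN] := sum_sq_le_ln Nx.
rewrite [X in _ <= X]sumrB sumN in YN0.
rewrite [X in 2 * X ^+ 2 + 3 * X]sumrB sumN in hN.
have /cards2P[i [j [ij PE]]] : #|P| == 2%N by rewrite K2.
have := sq; move: sE sumP (lnN) prodP; rewrite /s K2 w_1 PE !big_setU1 ?inE //= !big_set1.
have xi : 0 < x i by apply: Px; rewrite PE !inE eqxx.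
have xj : 0 < x j by apply: Px; rewrite PE !inE eqxx orbT.
rewrite w_1 in hN YN0.
set QN := \sum_(i in N) (_ - _) ^+ 2 in hN *.
set SN := \sum_(i in N) ln _ in YN0 hN *.
move: (x i) (x j) xi xj => a b a0 b0 e1 e2 SN0 pab eQ.
have Q5 : QN <= 5 by nra.
have eb : eps = 1 - a - b by lra.
have := mulr_ge0 dge0 z0; move=> hz.
have h8 : 4 <= lam * (a + b).
  have h1 : 4 * (a * b) <= (a + b) ^+ 2 by have := sqr_ge0 (a - b); lra.
  have h2 : a + b <= 1 by have := eps0; lra.
  have h3 : lam * (4 * (a * b)) <= lam * (a + b).
    rewrite ler_pM2l //; apply: le_trans h1 _.
    by rewrite expr2 ler_piMl //; lra.
  by lra.
have := mulr_gt0 a0 b0.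
by move: eQ hz; rewrite eb; lra.
Qed.

Lemma eigen_clash : False.
Proof.
move: wltP w0; case E : #|P| => [|[|[|k]]] wK wpos.
- by [].
- by have := leq_ltn_trans wpos wK.
- exact: clash_2 E.
- by apply: clash_ge3; rewrite E.
Qed.
End Clash.
End LogInequalities.

(** * Eigenvalues of a graph attaining equality *)

(** Negating the roots lets [pos_part_int] handle the negative eigenvalues too. *)
Lemma prod_XsubC_opp_int (R : comNzRingType) n (l : 'I_n -> R) (p : {poly int}) :
  \prod_i ('X - (l i)%:P) = map_poly intr p ->
  \prod_i ('X - (- l i)%:P) = map_poly intr ((-1) ^+ n *: (p \Po - 'X)).
Proof.
move=> e; rewrite map_polyZ map_comp_poly -e /= rmorphN /= map_polyX rmorph_prod /=.
rewrite rmorphXn rmorphN1 -[n in _ ^+ n]card_ord -mul_polyC rmorphXn rmorphN1.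
rewrite -prodr_const -big_split /=; apply: eq_bigr => i _.
by rewrite rmorphB /= comp_polyX comp_polyC rmorphN; ring.
Qed.

Section EqualityNumerics.
Variables (R : realType) (n : nat) (l : 'I_n -> R) (p : {poly int}).
Variables (d : R) (a b : int) (i0 : 'I_n).
Let P0 := [set i | 0 < l i].
Let N := [set i | l i < 0].
Let Z := [set i | l i == 0].
Hypothesis lp : \prod_i ('X - (l i)%:P) = map_poly intr p.
Hypotheses (b0 : 0 < b) (dab : b%:~R * d = a%:~R).
Hypotheses (l_sum : \sum_i l i = 0) (l_sq : \sum_i (l i) ^+ 2 = n%:R * d).
Hypothesis d_le : d <= l i0.
Hypothesis energy_eq : \sum_i `|l i| = #|[set i | l i != 0]|%:R + d - 1.

Let split3 (f : 'I_n -> R) :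
  \sum_i f i = \sum_(i in P0) f i + \sum_(i in N) f i + \sum_(i in Z) f i.
Proof.
rewrite (bigID (mem P0)) /= -addrA; congr (_ + _).
rewrite (bigID (mem N)) /=; congr (_ + _); apply: eq_bigl => i; rewrite !inE;
  by case: ltgtP.
Qed.

Let T := \sum_(i in P0) l i.
Let TN : \sum_(i in N) (- l i) = T.
Proof.
move: l_sum; rewrite split3 [X in _ + X]big1 => [|i]; last by rewrite inE => /eqP.
by rewrite sumrN /T; lra.
Qed.
Let card3 : n%:R = #|P0|%:R + #|N|%:R + #|Z|%:R :> R.
Proof.
have := split3 (fun=> 1); rewrite !sumr_const card_ord; apply.
Qed.
Let TE : 2 * T = #|P0|%:R + #|N|%:R + d - 1.
Proof.
have <- : #|[set i | l i != 0]|%:R = #|P0|%:R + #|N|%:R :> R.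
  have -> : [set i | l i != 0] = P0 :|: N.
    by apply/setP => i; rewrite !inE; case: ltgtP.
  rewrite -natrD -cardsUI (_ : P0 :&: N = set0) ?cards0 ?addn0 //.
  by apply/setP => i; rewrite !inE; case: ltgtP.
rewrite -energy_eq split3 [X in _ + X]big1 => [|i]; last first.
  by rewrite inE => /eqP->; rewrite normr0.
rewrite addr0.
have -> : 2 * T = T + \sum_(i in N) - l i by rewrite TN; ring.
congr (_ + _); apply: eq_bigr => i; rewrite inE => li.
  by rewrite gtr0_norm.
by rewrite ltr0_norm.
Qed.
Let T_rat : (b * (#|P0|%:Z + #|N|%:Z - 1) + a)%:~R = (2 * b)%:~R * T :> R.
Proof.
rewrite intrM -mulrA mulrCA TE !(rmorphM, rmorphD, rmorphB, rmorph1) /= -dab -!pmulrn.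
ring.
Qed.

Let d0 : 0 <= d.
Proof.
have n0 : 0 < n%:R :> R by rewrite ltr0n; case: (n) i0 => [[]|].
rewrite -(pmulr_rge0 _ n0) -l_sq; apply: sumr_ge0 => j _; exact: sqr_ge0.
Qed.
(** Otherwise [d = 0], so the sum of squares is zero, every [l j] vanishes and the energy equation
    reads [0 = -1]. *)
Let lam0 : 0 < l i0.
Proof.
rewrite ltNge; apply/negP => lam_le0.
have d00 : d = 0 by apply: le_anti; rewrite d0 (le_trans d_le).
have l0 : forall j, l j = 0.
  move: l_sq; rewrite d00 mulr0 => /eqP.
  rewrite psumr_eq0 => [/allP l0 j|j _]; last exact: sqr_ge0.
  by have := l0 j (mem_index_enum _); rewrite sqrf_eq0 => /eqP.
move: energy_eq; rewrite d00 big1 => [|j _]; last by rewrite l0 normr0.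
have -> : [set j | l j != 0] = set0 by apply/setP => j; rewrite !inE l0 eqxx.
by rewrite cards0; lra.
Qed.
Let i0P : i0 \in P0. Proof. by rewrite inE. Qed.
Let cP : #|P0|%:R = 1 + #|P0 :\ i0|%:R :> R.
Proof. by rewrite (cardsD1 i0) i0P natrD. Qed.

(** The excess [w] of [T] over [#|N|] is a natural number. If positive it contradicts [eigen_clash];
    if zero it leaves no room in [sum_sq_le_ln] on [N], so every negative eigenvalue is [-1]. *)
Lemma eigenvalue_ge_opp1 i : -1 <= l i.
Proof.
have bb : 0 < 2 * b by rewrite mulr_gt0.
have [T_int PP] := pos_part_int lp bb T_rat.
have NE : [set i | 0 < - l i] = N by apply/setP => j; rewrite !inE oppr_gt0.
have := pos_part_int (prod_XsubC_opp_int lp) bb.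
rewrite /= NE TN => /(_ _ T_rat)[_ PN].
pose x j := `|l j|; pose P := P0 :\ i0; pose lam := l i0.
have NP j : j \in N -> 0 < x j by rewrite inE /x => h; rewrite normr_gt0 lt_eqF.
have PP' j : j \in P -> 0 < x j.
  by rewrite !inE => /andP[_ h]; rewrite normr_gt0 gt_eqF.
have xN j : j \in N -> x j = - l j by rewrite inE /x => h; rewrite ltr0_norm.
have xP j : j \in P -> x j = l j by rewrite !inE /x => /andP[_ h]; rewrite gtr0_norm.
have prodN : 1 <= \prod_(j in N) x j by rewrite (eq_bigr _ xN).
have prodP : 1 <= lam * \prod_(j in P) x j.
  by rewrite (eq_bigr _ xP); move: PP; rewrite (big_setD1 i0).
have sN : \sum_(j in N) (x j - 1) = T - #|N|%:R.
  by rewrite sumrB (eq_bigr _ xN) TN sumr_const.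
pose s := \sum_(j in P) x j.
have sP : s = T - lam.
  by rewrite /T (big_setD1 i0) //= -/lam /s (eq_bigr _ xP); ring.
have [YN0 hN] := sum_sq_le_ln NP.
have lnN : 0 <= \sum_(j in N) ln (x j) by rewrite -ln_prod // ln_ge0.
rewrite [X in _ <= X]sumrB sN in YN0.
rewrite [X in 2 * X ^+ 2 + 3 * X]sumrB sN in hN.
(* Nonnegative because by [YN0] it is at least the sum of logarithms in [lnN]. *)
have w_nat : T - #|N|%:R \is a Num.nat.
  rewrite natrEint rpredB ?rpred_nat //=; lra.
case/natrP: w_nat => w ew.
have [w0|wpos] := posnP w; last first.
  exfalso; apply: (@eigen_clash R _ P N x lam (lam - d) #|Z|%:R w) => //.
  - by rewrite subr_ge0.
  - by rewrite subKr.
  - by rewrite sN ew.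
  - by have := TE; rewrite sumrB -/s sumr_const -ew sP cP;
      move: T #|P|%:R #|N|%:R => t k m; lra.
  have sq (B : {set 'I_n}) : \sum_(j in B) (x j - 1) ^+ 2 =
      \sum_(j in B) (l j) ^+ 2 - 2 * (\sum_(j in B) x j) + #|B|%:R.
    rewrite mulr_sumr -sumrB -sumr_const -big_split /=; apply: eq_bigr => j _.
    by rewrite /x sqrrB real_normK ?num_real // mulr1 expr1n -mulr_natl.
  rewrite !sq -/s (eq_bigr _ xN) TN subKr.
  have := l_sq; rewrite split3 (big_setD1 i0) //= -/lam -/P.
  rewrite [X in _ + X = _]big1 => [|j]; last first.
    by rewrite inE => /eqP->; rewrite expr0n.
  have := TE; have := card3; rewrite cP.
  move: (\sum_(j in P) l j ^+ 2) (\sum_(j in N) l j ^+ 2) => A2 B2.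
  move=> -> e1 e2.
  have -> : A2 = (1 + #|P|%:R + #|N|%:R + #|Z|%:R) * d - lam ^+ 2 - B2 by lra.
  have -> : #|N|%:R = 2 * T - d - #|P|%:R by lra.
  rewrite sP; ring.
move: (ltP (l i) 0) => [li|]; last by apply: le_trans; lra.
have iN : i \in N by rewrite inE.
have Q0 : \sum_(j in N) (x j - 1) ^+ 2 <= 0.
  move: YN0 hN; rewrite ew w0.
  move: (\sum_(j in N) ln _) lnN => S S0 S1.
  have -> : S = 0 by lra.
  by rewrite subrr expr0n !mulr0 addr0.
have : (x i - 1) ^+ 2 <= 0.
  apply: le_trans Q0; rewrite (bigD1 i) //= lerDl sumr_ge0 // => j _.
  exact: sqr_ge0.
by rewrite (xN _ iN); nra.
Qed.

(** Since [T = #|N|], the energy equation equates the nonnegative sum of [l i - 1] over [P] with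
    [d - lam <= 0]. Both vanish, so [lam = d] and the other positive eigenvalues are 1. *)
Lemma card_or_sq1_of_int_eigenvalues : (forall i, l i = -1 \/ l i \is a Num.nat) ->
  n%:R = d + 1 \/ forall i, l i ^+ 2 = 1.
Proof.
move=> l_int.
have lN i : i \in N -> l i = -1.
  by rewrite inE; case: (l_int i) => // /natr_ge0; rewrite leNgt => /negbTE->.
have lP i : i \in P0 -> 1 <= l i.
  rewrite inE; case: (l_int i) => [->|/natrP[k ->]]; first by rewrite oppr_gt0 ltr10.
  by rewrite ltr0n ler1n.
have T_N : T = #|N|%:R.
  rewrite -TN -[RHS]sumr_const; apply: eq_bigr => i /lN->; exact: opprK.
pose P := P0 :\ i0; pose lam := l i0.
have sP : \sum_(i in P) (l i - 1) = d - lam.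
  rewrite sumrB sumr_const; have := TE; rewrite T_N cP.
  by have := T_N; rewrite /T (big_setD1 i0) //= -/lam; lra.
have PP i : i \in P -> 0 <= l i - 1 by rewrite subr_ge0 inE => /andP[_ /lP].
have dl : d = lam.
  have : 0 <= \sum_(i in P) (l i - 1) by apply: sumr_ge0.
  by rewrite sP subr_ge0 => dl; apply: le_anti; rewrite d_le.
have l1 i : i \in P0 -> l i = if i == i0 then d else 1.
  case: (eqVneq i i0) => [->|ni] iP; first by rewrite dl.
  have iP' : i \in P by rewrite /P in_setD1 ni.
  move: sP; rewrite dl subrr => /eqP; rewrite psumr_eq0 //.
  move/allP/(_ i (mem_index_enum _)); by rewrite iP' subr_eq0 => /eqP.
have d1 : 1 <= d by rewrite dl lP.
have := l_sq; rewrite split3 (big_setD1 i0) //= -/lam -dl.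
rewrite (eq_bigr (fun=> 1)) => [|i]; last first.
  rewrite inE => /andP[]; rewrite inE => ni iP.
  by rewrite l1 // (negbTE ni) expr1n.
rewrite [X in _ + X + _](eq_bigr (fun=> 1)) => [|i /lN->]; last by rewrite sqrrN expr1n.
rewrite [X in _ + X = _]big1 => [|i]; last by rewrite inE => /eqP->; rewrite expr0n.
rewrite !sumr_const card3; have := TE; rewrite T_N cP.
move=> e1 e2.
have K0 : 0 <= #|P0 :\ i0|%:R :> R by [].
have Z0 : 0 <= #|Z|%:R :> R by [].
(* This is the sum of squares with all values inserted. Both terms are nonnegative, so [Z] is empty,
   and [P0 :\ i0] is empty unless [d = 1]. *)
have e3 : 2 * #|P0 :\ i0|%:R * (d - 1) + #|Z|%:R * d = 0 by nra.
have KZ : 0 <= #|P0 :\ i0|%:R * (d - 1) by apply: mulr_ge0 => //; lra.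
have zz : #|Z|%:R = 0 :> R by nra.
have [d_1|dn1] := eqVneq d 1; last first.
  left; have : #|P0 :\ i0|%:R * (d - 1) = 0 by nra.
  move/eqP; rewrite mulf_eq0 subr_eq0 (negbTE dn1) orbF => /eqP K00.
  by rewrite K00 zz; lra.
right => i; have [li|li|li] := ltgtP (l i) 0.
- by rewrite lN ?inE // sqrrN expr1n.
- by rewrite l1 ?inE // d_1 if_same expr1n.
- have : i \in Z by rewrite inE li.
  by move: zz => /eqP; rewrite pnatr_eq0 cards_eq0 => /eqP->; rewrite inE.
Qed.
End EqualityNumerics.

(** * Diagonalisation of real symmetric matrices *)

Lemma rank_diag_mx (F : fieldType) n (d : 'rV[F]_n) :
  \rank (diag_mx d) = (\sum_i (d 0 i != 0)%R)%N.
Proof.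
elim: n d => [|n IHn]; first by move=> d; rewrite big_ord0 flatmx0 mxrank0.
rewrite -[n.+1]/(1 + n)%N => d.
rewrite -{1}[d]hsubmxK diag_mx_row rank_diag_block_mx IHn.
rewrite big_split_ord /= big_ord1; congr (_ + _)%N; last first.
  by apply: eq_bigr => i _; rewrite mxE.
set M := diag_mx _; have -> : M = (d 0 (lshift n 0))%:M.
  by apply/matrixP => i j; rewrite !ord1 !mxE eqxx.
have [->|nz] := eqVneq; first by rewrite raddf0 mxrank0.
by rewrite -scalemx1 mxrank_scale_nz // mxrank1.
Qed.

(** Unitary diagonalisation over the complex numbers, with real diagonal. The [c i] are the squared
    moduli of the coordinates of [v] in an eigenbasis, so the same [c] serves all three forms. *)
Lemma sym_spectral (R : realType) n (A : 'M[R]_n) : A^T = A ->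
  exists l : 'I_n -> R,
  [/\ char_poly A = \prod_i ('X - (l i)%:P),
      \rank A = #|[set i | l i != 0]|,
      \tr A = \sum_i l i, \tr (A *m A) = \sum_i l i ^+ 2
    & forall v : 'rV_n, exists c : 'I_n -> R,
       [/\ forall i, 0 <= c i,
           (v *m v^T) 0 0 = \sum_i c i,
           (v *m A *m v^T) 0 0 = \sum_i l i * c i
         & (v *m (A *m A) *m v^T) 0 0 = \sum_i l i ^+ 2 * c i]].
Proof.
move=> symA; pose f := real_complex R; pose B := map_mx f A.
have hB : B \is hermsymmx.
  apply: realsym_hermsym.
    apply/is_hermitianmxP.
    by rewrite expr0 scale1r map_mx_id // /B map_trmx symA.
  by apply/mxOverP => i j; rewrite mxE; apply/complex_realP; exists (A i j).
have /mxOverP dreal := hermitian_spectral_diag_real hB.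
have /hermitian_normalmx/orthomx_spectralP eB := hB.
have Pu := spectral_unit B; have PU := spectral_unitarymx B.
set P := spectralmx B in eB Pu PU; set D := spectral_diag B in eB dreal.
pose l i := complex.Re (D 0 i).
have lD i : D 0 i = f (l i) by have /complex_realP[k ek] := dreal 0 i; rewrite /l ek.
have eBB : B *m B = invmx P *m diag_mx (\row_i (D 0 i) ^+ 2) *m P.
  rewrite {1 2}eB !mulmxA (mulmxK Pu) -(mulmxA (invmx P) (diag_mx D)) mulmx_diag.
  by congr (_ *m diag_mx _ *m _); apply/rowP => i; rewrite !mxE.
have trD d : \tr (invmx P *m diag_mx d *m P) = \sum_i d 0 i.
  by rewrite mxtrace_mulC mulmxA mulmxV // mul1mx mxtrace_diag.
exists l; split.
- apply: (map_poly_inj f); rewrite map_char_poly -/B.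
  have -> : char_poly B = char_poly (diag_mx D).
    rewrite eB /char_poly /char_poly_mx.
    have PV : map_mx polyC (invmx P) *m map_mx polyC P = 1%:M.
      by rewrite -map_mxM mulVmx // map_mx1.
    have -> : 'X%:M - map_mx polyC (invmx P *m diag_mx D *m P) =
        map_mx polyC (invmx P) *m ('X%:M - map_mx polyC (diag_mx D)) *m map_mx polyC P.
      rewrite mulmxBr mulmxBl !map_mxM; congr (_ - _).
      by rewrite scalar_mxC -mulmxA PV mulmx1.
    by rewrite !det_mulmx mulrAC -det_mulmx PV det1 mul1r.
  rewrite char_poly_trig; last exact/diag_mx_is_trig.
  rewrite rmorph_prod; apply: eq_bigr => i _.
  by rewrite mxE eqxx mulr1n rmorphB /= map_polyX map_polyC /= lD.
- rewrite -(mxrank_map f) -/B eB mxrankMfree ?row_free_unit //.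
  rewrite -mxrank_tr trmx_mul mxrankMfree ?row_free_unit ?unitmx_tr ?unitmx_inv //.
  rewrite tr_diag_mx rank_diag_mx -sum1_card [RHS]big_mkcond /=.
  by apply: eq_bigr => i _; rewrite inE lD fmorph_eq0; case: eqP.
- apply: (@complexI R); rewrite -[LHS](trace_map_mx f) -/B {1}eB trD (rmorph_sum f).
  by apply: eq_bigr => i _; rewrite lD.
- apply: (@complexI R); rewrite -[LHS](trace_map_mx f) map_mxM -/B eBB trD (rmorph_sum f).
  by apply: eq_bigr => i _; rewrite mxE lD rmorphXn.
move=> v; pose u := map_mx f v *m invmx P.
have quad (d : 'rV_n) : (map_mx f v *m (invmx P *m diag_mx d *m P) *m map_mx f v^T) 0 0
   = \sum_i d 0 i * (u 0 i * (u 0 i)^*%C).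
  have uC : (u ^t* )%sesqui = P *m map_mx f v^T.
    rewrite /u invmx_unitary // trmx_mul map_mxM trmxCK; congr (_ *m _).
    apply/matrixP => i j; rewrite !mxE.
    by apply: conj_Creal; apply/complex_realP; exists (v j i).
  rewrite !mulmxA -/u -mulmxA -uC mxE; apply: eq_bigr => i _.
  by rewrite mul_mx_diag !mxE; ring.
pose c i := complex.Re (u 0 i * (u 0 i)^*%C).
have cE i : u 0 i * (u 0 i)^*%C = f (c i).
  rewrite /c; case: (u 0 i) => a b; apply/eqP; rewrite eq_complex /= eqxx /=.
  by apply/eqP; ring.
have fin (d : 'rV_n) (e : 'I_n -> R) (M : 'M_n) :
    map_mx f M = invmx P *m diag_mx d *m P -> (forall i, d 0 i = f (e i)) ->
    (v *m M *m v^T) 0 0 = \sum_i e i * c i.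
  move=> eM de; apply: (@complexI R).
  have := quad d; rewrite -eM -!map_mxM mxE => q; apply: etrans q _.
  rewrite (rmorph_sum f); apply: eq_bigr => i _.
  by rewrite de cE -rmorphM.
exists c; split.
- by move=> i; rewrite /c; case: (u 0 i) => a b /=;
    rewrite mulrN opprK addr_ge0 // -expr2 sqr_ge0.
- rewrite -[v in v *m _]mulmx1 (fin (const_mx 1) (fun=> 1)).
  + by apply: eq_bigr => i _; rewrite mul1r.
  + by rewrite map_mx1 diag_const_mx mulmx1 mulVmx.
  + by move=> i; rewrite mxE; apply: esym (rmorph1 f).
- exact: fin eB lD.
apply: (fin (\row_i D 0 i ^+ 2) (fun i => l i ^+ 2)); first by rewrite map_mxM.
by move=> i; rewrite mxE lD; apply: esym (rmorphXn f 2 (l i)).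
Qed.

(** * Graphs and their spectra *)

Section GraphSpectrum.
Variables (R : realType) (G : sgraph).
Local Notation n := #|G|.
Local Notation A := (adjmx R G).
Local Notation d := (avg_degree R G).

(** Ordered adjacent pairs are grouped by their edge; the fibre of [[set x; y]] is [(x, y)] and
    [(y, x)]. *)
Lemma handshake : (\sum_(x : G) \sum_(y : G) adj x y = 2 * #|edges G|)%N.
Proof.
rewrite pair_big /=.
transitivity (\sum_(u : G * G | adj u.1 u.2) 1)%N.
  by rewrite [RHS]big_mkcond; apply: eq_bigr => u _; case: (adj _ _).
pose h (u : G * G) : {set G} := [set u.1; u.2].
rewrite (partition_big h (mem (edges G))) => [|[x y] /= xy]; last first.
  by rewrite inE; apply/existsP; exists x; apply/existsP; exists y; rewrite xy /=.
rewrite mulnC -sum_nat_const; apply: eq_bigr => E.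
rewrite -[mem _ _]/(E \in edges G) inE => /existsP[x /existsP[y /andP[xy /eqP->]]].
have nxy : x != y by apply: contraTneq xy => ->; rewrite adj_irrefl.
transitivity #|[set (x, y); (y, x)]|; last by rewrite cards2 xpair_eqE (negbTE nxy).
rewrite -sum1_card; apply: eq_bigl => -[a b]; rewrite !inE /h /= !xpair_eqE.
apply/andP/orP => [[ab /eqP e]|].
  have : a \in [set x; y] by rewrite -e !inE eqxx.
  have : b \in [set x; y] by rewrite -e !inE eqxx orbT.
  rewrite !inE => /orP[]/eqP eb /orP[]/eqP ea;
    move: ab; rewrite ea eb ?adj_irrefl // => _.
    by right; rewrite !eqxx.
  by left; rewrite !eqxx.
by case=> /andP[/eqP-> /eqP->]; rewrite ?xy ?eqxx // adj_sym xy setUC eqxx.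
Qed.

Lemma avg_degree_sum : (0 < n)%N ->
  n%:R * d = \sum_(x : G) \sum_(y : G) (adj x y)%:R.
Proof.
move=> n0; rewrite /avg_degree mulrC divfK ?pnatr_eq0 -?lt0n //.
rewrite -natrM -handshake natr_sum; apply: eq_bigr => x _.
by rewrite natr_sum.
Qed.

Lemma adjmx_charpoly_int : char_poly A = map_poly intr (char_poly
   (\matrix_(i, j) (adj (enum_val i) (enum_val j))%:R : 'M[int]_n)).
Proof.
rewrite map_char_poly; congr char_poly; apply/matrixP => i j.
by rewrite !mxE /= rmorph_nat.
Qed.

Lemma sum_enum_val (T : finType) (M : nmodType) (f : T -> M) :
  \sum_(i < #|T|) f (enum_val i) = \sum_x f x.
Proof. by rewrite [RHS](reindex _ (onW_bij _ (enum_val_bij T))). Qed.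

(** The function [g] will be constant for the Rayleigh bound, a signed path for the cliques, and the
    indicator of a vertex for its degree. *)
Lemma adjmx_spectrum : exists l : 'I_n -> R,
  [/\ [/\ char_poly A = \prod_i ('X - (l i)%:P),
          energy R G = \sum_i `|l i|
        & graph_rank R G = #|[set i | l i != 0]| ],
      \sum_i l i = 0, (0 < n)%N -> \sum_i l i ^+ 2 = n%:R * d
    & forall g : G -> R, exists c : 'I_n -> R,
       [/\ forall i, 0 <= c i, \sum_x g x ^+ 2 = \sum_i c i,
           \sum_x \sum_y g x * g y * (adj x y)%:R = \sum_i l i * c i
         & \sum_y (\sum_x g x * (adj x y)%:R) ^+ 2 = \sum_i l i ^+ 2 * c i]].
Proof.
have symA := adjmx_sym R G.
have [l [cp rk tr1 tr2 quad]] := sym_spectral symA.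
exists l; split.
- split=> //; rewrite /energy.
  have pe : perm_eq (eigenvalues A) [seq l i | i <- enum 'I_n].
    apply: prod_XsubC_eq; rewrite -char_poly_eigenvalues // cp.
    by rewrite big_map big_enum.
  by rewrite (perm_big _ pe) /= big_map big_enum.
- by rewrite -tr1; apply: big1 => i _; rewrite mxE adj_irrefl.
- move=> n0; rewrite -tr2 avg_degree_sum // /mxtrace -[RHS]sum_enum_val.
  apply: eq_bigr => i _; rewrite mxE -[RHS]sum_enum_val; apply: eq_bigr => j _.
  by rewrite !mxE [adj (enum_val j) _]adj_sym -natrM mulnb andbb.
move=> g; have [c [c0 c1 c2 c3]] := quad (\row_i g (enum_val i)).
exists c; split=> //.
- rewrite -c1 mxE -[LHS]sum_enum_val; apply: eq_bigr => i _.
  by rewrite !mxE expr2.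
- rewrite -c2 mxE exchange_big /= -[LHS]sum_enum_val; apply: eq_bigr => j _.
  rewrite !mxE mulr_suml -[LHS]sum_enum_val; apply: eq_bigr => i _.
  by rewrite !mxE; ring.
rewrite -c3 mulmxA -{2}symA -mulmxA -trmx_mul mxE -[LHS]sum_enum_val.
apply: eq_bigr => i _; rewrite [X in _ = _ * X]mxE -expr2; congr (_ ^+ 2).
by rewrite mxE -[LHS]sum_enum_val; apply: eq_bigr => j _; rewrite !mxE.
Qed.
End GraphSpectrum.

(** * Disjoint unions of cliques *)

Section Cliques.
Variables (R : realType) (G : sgraph).
Local Notation A := (adjmx R G).

Lemma adjmx_eigenvector (mu : R) : root (char_poly A) mu ->
  exists2 g : G -> R, exists x, g x != 0 &
    forall y, \sum_x g x * (adj x y)%:R = mu * g y.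
Proof.
rewrite -eigenvalue_root_char => /eigenvalueP[v vA v0].
exists (fun x => v 0 (enum_rank x)).
  have [i vi] : exists i, v 0 i != 0.
    apply/existsP; apply: contraNT v0 => /existsPn v0.
    by apply/eqP/rowP => i; rewrite mxE; apply/eqP; have := v0 i; rewrite negbK.
  by exists (enum_val i); rewrite enum_valK.
move=> y; have /rowP/(_ (enum_rank y)) := vA; rewrite !mxE => <-.
rewrite -[LHS]sum_enum_val; apply: eq_bigr => i _.
by rewrite mxE enum_valK enum_rankK.
Qed.

(** The relation with matrix A + I; it is transitive exactly when the graph is a disjoint union of
    cliques. *)
Definition adj_eq (x y : G) := (x == y) || adj x y.
Definition nbhd (x : G) := [set y | adj_eq x y].

Lemma adj_eq_sym x y : adj_eq x y = adj_eq y x.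
Proof. by rewrite /adj_eq eq_sym adj_sym. Qed.

Lemma sum_nbhd (g : G -> R) y :
  \sum_(x in nbhd y) g x = g y + \sum_x g x * (adj x y)%:R.
Proof.
rewrite (bigD1 y) /=; last by rewrite inE /adj_eq eqxx.
congr (_ + _); rewrite big_mkcond /=; apply: eq_bigr => x _.
rewrite inE /adj_eq [adj y x]adj_sym eq_sym.
by case: eqVneq => [->|_] /=; rewrite ?andbT ?adj_irrefl ?mulr0 //; case: (adj _ _);
  rewrite ?mulr1 ?mulr0.
Qed.

(** Summing an eigenvector [g] over the clique of [y] gives [(mu + 1) * g y]. So if [mu] is not
    [-1], [g] is constant on each clique, and a clique where it is nonzero has size [mu + 1]. *)
Lemma clique_eigenvalue (mu : R) : transitive adj_eq -> root (char_poly A) mu ->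
  mu = -1 \/ exists x, mu = #|nbhd x|%:R - 1.
Proof.
move=> tr /adjmx_eigenvector[g [x gx] eg].
have S y : \sum_(z in nbhd y) g z = (mu + 1) * g y.
  by rewrite sum_nbhd eg; ring.
have [e|ne] := eqVneq mu (-1); [by left | right; exists x].
have mu1 : mu + 1 != 0 by rewrite addr_eq0.
have gE y : y \in nbhd x -> g y = g x.
  rewrite inE => xy; apply: (mulfI mu1); rewrite -!S; apply: eq_bigl => z.
  rewrite !inE; apply/idP/idP; last by apply: tr; rewrite adj_eq_sym.
  exact: tr.
have := S x; rewrite (eq_bigr _ gE) sumr_const -[g x *+ _]mulr_natl => e.
by have := mulIf gx e; lra.
Qed.

Lemma adj_eq_trans_of_ge_opp1 (l : 'I_#|G| -> R) :
    (forall i, -1 <= l i) ->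
    (forall g : G -> R, exists c : 'I_#|G| -> R,
       [/\ forall i, 0 <= c i, \sum_x g x ^+ 2 = \sum_i c i
         & \sum_x \sum_y g x * g y * (adj x y)%:R = \sum_i l i * c i]) ->
  transitive adj_eq.
Proof.
move=> l1 quad y x z xy yz; apply: contraT => nxz.
move: nxz xy yz; rewrite /adj_eq negb_or => /andP[nxz axz].
case: (eqVneq x y) => [<-|nxy] /=; first by rewrite (negbTE nxz) (negbTE axz).
move=> axy; case: (eqVneq y z) => [ez|nyz] /=; first by rewrite -ez axy in axz.
move=> ayz.
(* A + I is negative at this vector if x, y, z is an induced path. *)
pose g t : R := (t == x)%:R - (t == y)%:R + (t == z)%:R.
have [c [c0 c1 c2]] := quad g.
have sumg (f : G -> R) : \sum_t g t * f t = f x - f y + f z.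
  have delta u : \sum_t (t == u)%:R * f t = f u.
    rewrite (bigD1 u) //= eqxx mul1r big1 ?addr0 // => t /negbTE->.
    by rewrite mul0r.
  rewrite -!delta -sumrB -big_split /=; apply: eq_bigr => t _; rewrite /g; ring.
have : 0 <= \sum_i (l i + 1) * c i.
  by apply: sumr_ge0 => i _; rewrite mulr_ge0 // -lerBlDr sub0r.
under eq_bigr do rewrite mulrDl mul1r.
rewrite big_split /= -c1 -c2.
have -> : \sum_t g t ^+ 2 = 3.
  under eq_bigr do rewrite expr2.
  rewrite sumg /g !eqxx [y == x]eq_sym [z == x]eq_sym [z == y]eq_sym.
  by rewrite (negbTE nxy) (negbTE nxz) (negbTE nyz) /=; ring.
(* Each of the two edges of the path counts twice with sign -1, so the form of A + I takes the value
   3 - 4. *)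
have -> : \sum_t \sum_u g t * g u * (adj t u)%:R = -4.
  have -> : \sum_t \sum_u g t * g u * (adj t u)%:R =
      \sum_t g t * (\sum_u g u * (adj t u)%:R).
    by apply: eq_bigr => t _; rewrite mulr_sumr; apply: eq_bigr => u _; rewrite mulrA.
  rewrite sumg !sumg !adj_irrefl [adj y x]adj_sym [adj z x]adj_sym [adj z y]adj_sym.
  by rewrite axy ayz (negbTE axz) /=; ring.
lra.
Qed.
End Cliques.

(** * Recognising complete graphs and perfect matchings *)

Lemma graph_iso_complete (G : sgraph) :
  (forall x y : G, adj x y = (x != y)) -> graph_iso G (complete #|G|).
Proof.
move=> adjE; exists enum_rank; first exact: enum_rank_bij.
by move=> x y; rewrite adjE /= /complete_adj (inj_eq enum_rank_inj).
Qed.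

Section Matching.
Variables (G : sgraph) (f : G -> G).
Hypothesis adjE : forall x y, adj x y = (y == f x).

Let fK : involutive f.
Proof. by move=> x; apply/eqP; rewrite eq_sym -adjE adj_sym adjE. Qed.
Let f_neq x : f x != x.
Proof. by apply/negP => /eqP e; have := adj_irrefl x; rewrite adjE e eqxx. Qed.

(** A transversal of the edges, which [f] exchanges with its complement; its elements index the
    copies of K_2. *)
Let S := [set x | (enum_rank x < enum_rank (f x))%N].
Let fS x : (f x \in S) = (x \notin S).
Proof.
rewrite !inE fK -leqNgt [RHS]leq_eqVlt orb_idl // => /eqP/val_inj/enum_rank_inj e.
by have := f_neq x; rewrite e eqxx.
Qed.
Let cardS : #|G| = (#|S| * 2)%N.
Proof.
have SC : ~: S = f @: S.
  apply/setP => x; rewrite inE -fS; apply/idP/imsetP => [fx|[y yS ->]].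
    by exists (f x).
  by rewrite fK.
by rewrite -(cardsC S) SC card_imset ?muln2 ?addnn //; apply: inv_inj.
Qed.
Let rep x := if x \in S then x else f x.
Let rep_S x : rep x \in S.
Proof. by rewrite /rep; case: ifP => // /negbT; rewrite fS. Qed.

Lemma graph_iso_matching : (0 < #|G|)%N ->
  ~~ odd #|G| /\ graph_iso G (copies #|G|./2 (complete 2)).
Proof.
move=> G0; have [x0 _] : exists x0 : G, x0 \in G by apply/card_gt0P.
have half : #|G|./2 = #|S| by rewrite cardS muln2 doubleK.
split; first by rewrite cardS muln2 odd_double.
rewrite half.
pose g x : copies #|S| (complete 2) :=
  (enum_rank_in (rep_S x0) (rep x), if x \in S then ord0 else ord_max).
have gE x y : ((g x).1 == (g y).1) = (rep x == rep y).
  rewrite /=; apply/eqP/eqP => [/(congr1 enum_val)|-> //].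
  by rewrite !enum_rankK_in.
have g_inj : injective g.
  move=> x y e; have /eqP : rep x == rep y by rewrite -gE e.
  have := congr1 snd e => /= e2.
  by move: e2; rewrite /rep; do 2!case: ifP => _ //; move=> _ // /(inv_inj fK).
exists g.
  apply: inj_card_bij g_inj _.
  by rewrite card_prod !card_ord cardS.
move=> x y; rewrite adjE /= /copies_adj gE /= /complete_adj /rep.
have := fS x; case: ifPn => xS; case: ifPn => yS //= fx; rewrite ?andbF ?andbT.
- by apply/esym/eqP => e; rewrite -e yS in fx.
- by rewrite eq_sym; apply/eqP/eqP => [<-|->]; rewrite ?fK.
- by rewrite eq_sym.
- by apply/esym/eqP => e; rewrite -e (negbTE yS) in fx.
Qed.
End Matching.

Lemma root_prod_ord (F : idomainType) m (l : 'I_m -> F) i :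
  root (\prod_j ('X - (l j)%:P)) (l i).
Proof.
by rewrite rootE horner_prod (bigD1 i) //= hornerXsubC subrr mul0r.
Qed.

(** * The two directions of the equivalence *)

Section Equality.
Variables (R : realType) (G : sgraph).
Local Notation n := #|G|.
Local Notation d := (avg_degree R G).
Hypothesis n_gt1 : (1 < n)%N.

Let n0 : (0 < n)%N. Proof. exact: ltnW. Qed.
Let nR0 : 0 < n%:R :> R. Proof. by rewrite ltr0n. Qed.

(** On the two possible eigenvalues -1 and k - 1, both the square and the absolute value are affine
    functions of the eigenvalue, so trace zero determines their sums. *)
Lemma energy_eq_of_cliques k : transitive (@adj_eq G) ->
    (forall x : G, #|nbhd x| = k) -> (1 < k)%N ->
  k = 2%N \/ k = n ->
  energy R G = (graph_rank R G)%:R + d - 1.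
Proof.
move=> tr nk k1 k2n; have [l [[cp -> ->] l_sum l_sq _]] := adjmx_spectrum R G.
have k_gt1 : 1 < k%:R :> R by rewrite ltr1n.
have lE i : l i = -1 \/ l i = k%:R - 1.
  have [] := @clique_eigenvalue R G (l i) tr.
  - by rewrite cp; apply: root_prod_ord.
  - by left.
  by case=> x; rewrite nk; right.
have -> : [set i | l i != 0] = [set: 'I_n].
  apply/setP => i; rewrite !inE; case: (lE i) => ->; rewrite ?oppr_eq0 ?oner_eq0 //.
  by rewrite subr_eq0 gt_eqF.
rewrite cardsT card_ord.
have dE : d = k%:R - 1.
  apply: (mulfI (lt0r_neq0 nR0)); rewrite -l_sq //.
  have -> : \sum_i l i ^+ 2 = (k%:R - 2) * \sum_i l i + \sum_(i < n) (k%:R - 1).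
    by rewrite mulr_sumr -big_split; apply: eq_bigr => i _ /=; case: (lE i) => ->; ring.
  by rewrite l_sum sumr_const card_ord -[_ *+ n]mulr_natl; ring.
have -> : \sum_i `|l i| = n%:R * (2 * (k%:R - 1) / k%:R).
  have -> : \sum_i `|l i| = (k%:R - 2) / k%:R * \sum_i l i
      + \sum_(i < n) (2 * (k%:R - 1) / k%:R).
    rewrite mulr_sumr -big_split; apply: eq_bigr => i _ /=.
    have kn0 : k%:R != 0 :> R by rewrite gt_eqF //; lra.
    case: (lE i) => ->; first by rewrite normrN1; field.
    by rewrite ger0_norm ?subr_ge0 ?ltW //; field.
  by rewrite l_sum sumr_const card_ord -[_ *+ n]mulr_natl; ring.
(* The two sides differ by (k - 2)(n - k)/k. *)
rewrite dE; case: k2n => [->|->]; first by field.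
by field; rewrite gt_eqF.
Qed.

Lemma dichotomy_of_energy_eq :
  energy R G = (graph_rank R G)%:R + d - 1 ->
  (forall x y : G, adj x y = (x != y)) \/
  exists f : G -> G, forall x y, adj x y = (y == f x).
Proof.
have [l [[cp -> ->] l_sum l_sq quad]] := adjmx_spectrum R G.
move=> eE; have dn := avg_degree_sum R n0.
have [i0 l_max] : exists i0, forall i, l i <= l i0.
  have i1 : 'I_n := Ordinal n0.
  by case: (@arg_maxP _ _ _ i1 predT l) => // i _ h; exists i => j; apply: h.
have d_le : d <= l i0.
  (* Rayleigh quotient of the all-ones vector. *)
  have [c [c0 c1 c2 _]] := quad (fun=> 1).
  rewrite -(ler_pM2l nR0) dn.
  under eq_bigr do under eq_bigr do rewrite -[_%:R]mul1r -{1}(mulr1 1).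
  rewrite c2; have -> : n%:R = \sum_i c i.
    rewrite -c1; under eq_bigr do rewrite expr1n.
    by rewrite sumr_const.
  by rewrite mulr_suml; apply: ler_sum => i _; rewrite mulrC ler_wpM2l.
have lp := etrans (esym cp) (adjmx_charpoly_int R G).
have nd : (n%:Z)%:~R * d = (2 * #|edges G|)%:Z%:~R :> R.
  by rewrite -!pmulrn natrM /avg_degree mulrC divfK // gt_eqF.
have n0Z : 0 < n%:Z by [].
have l1 := eigenvalue_ge_opp1 lp n0Z nd l_sum (l_sq n0) d_le eE.
have tr : transitive (@adj_eq G).
  apply: adj_eq_trans_of_ge_opp1 l1 _ => g.
  by have [c [? ? ? _]] := quad g; exists c; split.
have l_int i : l i = -1 \/ l i \is a Num.nat.
  have [] := @clique_eigenvalue R G (l i) tr.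
  - by rewrite cp; apply: root_prod_ord.
  - by left.
  case=> x ->; right; have : (0 < #|nbhd x|)%N.
    by apply/card_gt0P; exists x; rewrite inE /adj_eq eqxx.
  by case: #|_| => // k _; rewrite -natr1 addrK rpred_nat.
case: (card_or_sq1_of_int_eigenvalues l_sum (l_sq n0) d_le eE l_int) => [nE|l_1].
  left; have sum_neq x : \sum_(y : G) (x != y)%:R = n%:R - 1 :> R.
    rewrite (bigD1 x) //= eqxx add0r (eq_bigr (fun=> 1)) => [|y].
      by rewrite sumr_const cardC1 -[n in RHS]prednK // -natr1 addrK.
    by rewrite eq_sym => ->.
  have adj_le x y : 0 <= (x != y)%:R - (adj x y)%:R :> R.
    rewrite subr_ge0 ler_nat; case: eqVneq => [->|_]; first by rewrite adj_irrefl.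
    exact: leq_b1.
  (* With n = d + 1 the nonnegative entries of J - I - A, where J is the all-ones matrix, sum to
     zero. *)
  have : \sum_(x : G) \sum_(y : G) ((x != y)%:R - (adj x y)%:R) = 0 :> R.
    under eq_bigr do rewrite sumrB sum_neq.
    have sum_c : \sum_(x : G) (n%:R - 1) = n%:R * (n%:R - 1) :> R.
      by rewrite sumr_const [RHS]mulr_natl.
    by rewrite sumrB -dn sum_c nE; ring.
  move/eqP; rewrite psumr_eq0 => [/allP h x y|x _]; last exact: sumr_ge0.
  have := h x (mem_index_enum _); rewrite psumr_eq0 //= => /allP/(_ y (mem_index_enum _)).
  by rewrite /= subr_eq0 eqr_nat; case: (adj x y); case: (x != y).
(* All eigenvalues of the square of A are 1, and its diagonal entry at [x] is the degree of [x]. *)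
right; have deg (x : G) : #|[set y | adj x y]| = 1%N.
  have [c [_ c1 _ c3]] := quad (fun z => (z == x)%:R).
  have delta (h : G -> R) : \sum_z (z == x)%:R * h z = h x.
    rewrite (bigD1 x) //= eqxx mul1r big1 ?addr0 // => z /negbTE->.
    by rewrite mul0r.
  have c_sum : \sum_i c i = 1.
    by rewrite -c1; under eq_bigr do rewrite expr2; rewrite delta eqxx.
  apply/eqP; rewrite -(eqr_nat R); apply/eqP; transitivity (\sum_i l i ^+ 2 * c i).
    rewrite -c3 -sum1dep_card natr_sum big_mkcond; apply: eq_bigr => y _.
    by rewrite delta; case: (adj x y); rewrite ?expr1n ?expr0n.
  by rewrite -[RHS]c_sum; apply: eq_bigr => i _; rewrite l_1 mul1r.
have {}deg (x : G) : {y | [set z | adj x z] = [set y]}.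
  have : [exists y, [set z | adj x z] == [set y]].
    by have /eqP/cards1P[y e] := deg x; apply/existsP; exists y; rewrite e.
  by case/existsP/sigW => y /eqP e; exists y.
exists (fun x => sval (deg x)) => x y.
by case: (deg x) => z /= /setP/(_ y); rewrite !inE.
Qed.
End Equality.

Theorem theorem1p2 (R : realType) (G : sgraph) (n : nat)
    (hn : (5 <= n)%N) (hG : #|G| = n) :
  energy R G = (graph_rank R G)%:R + avg_degree R G - 1 <->
  graph_iso G (complete n) \/
  ~~ odd n /\ graph_iso G (copies n./2 (complete 2)).
Proof.
subst n; have n1 : (1 < #|G|)%N by apply: leq_trans hn.
split=> [/(dichotomy_of_energy_eq n1)[adjE|[f adjE]]|].
- by left; apply: graph_iso_complete.
- by right; apply: graph_iso_matching adjE (ltnW n1).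
case=> [[f fbij fadj]|[_ [f fbij fadj]]].
  have adjE (x y : G) : adj_eq x y.
    rewrite /adj_eq -fadj /= /complete_adj (inj_eq (bij_inj fbij)).
    by case: eqP.
  apply: (@energy_eq_of_cliques _ _ n1 #|G|); rewrite ?n1 //; last by right.
  move=> x; rewrite -cardsT; congr #|pred_of_set _|.
  by apply/setP => y; rewrite !inE adjE.
(* K_2 is complete, so equal or adjacent means lying in the same copy. *)
have adjE (x y : G) : adj_eq x y = ((f x).1 == (f y).1).
  rewrite /adj_eq -fadj /= /copies_adj /= /complete_adj -(inj_eq (bij_inj fbij)).
  by case: (f x) (f y) => [a i] [b j]; rewrite xpair_eqE /=; do 2!case: eqP.
apply: (@energy_eq_of_cliques _ _ n1 2%N); rewrite ?n1 //; last by left.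
  by move=> y x z; rewrite !adjE => /eqP->.
move=> x; have -> : nbhd x = f @^-1: [set ((f x).1, ord0); ((f x).1, ord_max)].
  apply/setP => y; rewrite !inE adjE.
  case: (f y) => [b j] /=; rewrite !xpair_eqE eq_sym; case: eqP => //= _.
  by case: j => [[|[]]].
rewrite on_card_preimset; last exact: onW_bij.
by rewrite cards2 xpair_eqE eqxx.
Qed.
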